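(* Fix a prime $p>0$ and let $A$ be a ring with a nonzero divisor $\varpi\in A$. Assume that $\varpi$ admits a compatible system of $p$-power roots $\varpi^{1/p^n}\in A$ ($n\ge 1$), and let $\varpi^\flat:=(\ldots,\varpi^{1/p^2},\varpi^{1/p},\varpi)\in A^\flat$ be the corresponding element of the tilt $A^\flat$. Then the following assertions hold. (1) If $A$ is $p$-adically complete and completely integrally closed in $A[\frac{1}{\varpi}]$, then $A^\flat$ is completely integrally closed in $A^\flat[\frac{1}{\varpi^\flat}]$. (2) If $A$ is completely integrally closed in $A[\frac{1}{\varpi}]$, and the $\varpi$-adic topology coincides with the $p$-adic topology on $A$, then $A^\flat$ is completely integrally closed in $A^\flat[\frac{1}{\varpi^\flat}]$.
   Context: All rings are commutative with $1$, not necessarily Noetherian. ''$I$-adically complete'' always includes ''$I$-adically separated''. A compatible system of $p$-power roots of $\varpi$ in $A$ means elements $\varpi^{1/p^n}\in A$ ($n\ge 0$) with $\varpi^{1/p^0}=\varpi$ and $(\varpi^{1/p^{n+1}})^p=\varpi^{1/p^n}$ for all $n\ge 0$. The tilt of $A$ is the ring $A^\flat:=\varprojlim\{\cdots\to A/pA\to A/pA\}$, where every transition map is the Frobenius map $x\mapsto x^p$ on $A/pA$; its elements are written $(\ldots,a_1,a_0)$ with $a_n\in A/pA$ and $a_{n+1}^p=a_n$. The element $\varpi^\flat\in A^\flat$ is the sequence of residue classes modulo $p$ of the $\varpi^{1/p^n}$. For a ring extension $A\to B$, an element $x\in B$ is almost integral over $A$ if the $A$-submodule $\sum_{n=0}^\infty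 Ax^n\subset B$ is contained in a finitely generated $A$-submodule of $B$. $A$ is completely integrally closed in $B$ if every element of $B$ that is almost integral over $A$ belongs to $A$. When $B=A[\frac1t]$ for a nonzero divisor $t\in A$, $x\in B$ is almost integral over $A$ if and only if there is $c\in\mathbb{N}$ such that $t^cx^n\in A$ for all $n\ge 0$. *)

(* Defs.v *)
From HB Require Import structures.
From mathcomp Require Import all_boot all_order all_algebra.
From mathcomp Require Import mathcomp_extra boolp classical_sets functions.
From mathcomp Require Import ring.

Set Implicit Arguments.
Unset Strict Implicit.
Unset Printing Implicit Defensive.

Import GRing.Theory.

Local Open Scope ring_scope.
Local Open Scope quotient_scope.

(* Rings are [comPzRingType]s: the zero ring is allowed, since for instance
   A/pA vanishes when p is invertible in A. *)

Section PrincipalQuotient.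
Variables (A : comPzRingType) (a : A).

Definition principal : {pred A} := fun x => `[< exists y, x = a * y >].

Lemma principalP x : reflect (exists y, x = a * y) (x \in principal).
Proof. exact: asboolP. Qed.

Lemma principal_zmod_closed : zmod_closed principal.
Proof.
split; first by apply/principalP; exists 0; rewrite mulr0.
move=> x y /principalP[u ->] /principalP[v ->].
by apply/principalP; exists (u - v); rewrite mulrBr.
Qed.

HB.instance Definition _ :=
  GRing.isZmodClosed.Build A principal principal_zmod_closed.

Lemma principalMl x y : y \in principal -> x * y \in principal.
Proof.
by move=> /principalP[u ->]; apply/principalP; exists (x * u); rewrite mulrCA.
Qed.

(* MathComp puts a ring structure on a quotient only for proper ideals of
   nontrivial rings, hence the instances below on top of its additive
   quotient. *)
Definition quot_by := Quotient.quot principal.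

HB.instance Definition _ := GRing.Zmodule.on quot_by.
HB.instance Definition _ := EqQuotient.on quot_by.

Definition quot_proj (x : A) : quot_by := \pi_quot_by x.

Lemma quot_projP x y : quot_proj x = quot_proj y <-> x - y \in principal.
Proof.
by rewrite Quotient.idealrBE; split => [h|/eqP //]; apply/eqP; exact: h.
Qed.

Lemma quot_projK (x : quot_by) : quot_proj (repr x) = x.
Proof. exact: reprK. Qed.

Let one : quot_by := quot_proj 1.
Let mul (x y : quot_by) : quot_by := quot_proj (repr x * repr y).

Let mulE x y : mul (quot_proj x) (quot_proj y) = quot_proj (x * y).
Proof.
have rK z : repr (quot_proj z) - z \in principal.
  by apply/quot_projP; rewrite quot_projK.
apply/quot_projP; set u := repr _; set v := repr _.
have -> : u * v - x * y = v * (u - x) + x * (v - y) by ring.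
by rewrite rpredD // principalMl // rK.
Qed.

Let projD x y : quot_proj (x + y) = quot_proj x + quot_proj y.
Proof. exact: (@pi_addr _ _ _ _ _ (Quotient.quot principal)). Qed.

Let mulA : associative mul.
Proof.
move=> x y z; rewrite -[x]quot_projK -[y]quot_projK -[z]quot_projK.
by rewrite !mulE mulrA.
Qed.

Let mulC : commutative mul.
Proof.
by move=> x y; rewrite -[x]quot_projK -[y]quot_projK !mulE mulrC.
Qed.

Let mul1 : left_id one mul.
Proof. by move=> x; rewrite -[x]quot_projK mulE mul1r. Qed.

Let mulDl : left_distributive mul +%R.
Proof.
move=> x y z; rewrite -[x]quot_projK -[y]quot_projK -[z]quot_projK.
by rewrite -projD !mulE mulrDl projD.
Qed.

HB.instance Definition _ :=
  GRing.Zmodule_isComPzRing.Build quot_by mulA mulC mul1 mulDl.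

Lemma quot_proj_is_zmod_morphism : zmod_morphism quot_proj.
Proof.
move=> x y; rewrite projD; congr (_ + _).
exact: (@pi_oppr _ _ _ _ _ (Quotient.quot principal)).
Qed.

Lemma quot_proj_is_monoid_morphism : monoid_morphism quot_proj.
Proof. by split=> // x y; rewrite -mulE. Qed.

HB.instance Definition _ :=
  GRing.isZmodMorphism.Build A quot_by quot_proj quot_proj_is_zmod_morphism.
HB.instance Definition _ :=
  GRing.isMonoidMorphism.Build A quot_by quot_proj
    quot_proj_is_monoid_morphism.

End PrincipalQuotient.

Section Localization.
Variables (A : comPzRingType) (t : A).

(* The pair (a, m) stands for a / t ^ m. *)
Definition loc_rel (x y : A * nat) : bool :=
  `[< exists k, t ^+ k * (x.1 * t ^+ y.2) = t ^+ k * (y.1 * t ^+ x.2) >].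

Lemma loc_rel_equiv : equiv_class_of loc_rel.
Proof.
split=> [x|x y|y x z]; first by apply/asboolP; exists 0%N.
  by apply/asboolP/asboolP => -[k e]; exists k.
move=> /asboolP[k e] /asboolP[l f]; apply/asboolP; exists (k + l + y.2)%N.
have -> : t ^+ (k + l + y.2) * (x.1 * t ^+ z.2) =
    t ^+ l * t ^+ z.2 * (t ^+ k * (x.1 * t ^+ y.2)) by rewrite !exprD; ring.
have -> : t ^+ (k + l + y.2) * (z.1 * t ^+ x.2) =
    t ^+ k * t ^+ x.2 * (t ^+ l * (z.1 * t ^+ y.2)) by rewrite !exprD; ring.
by rewrite e -f; ring.
Qed.

Canonical loc_rel_equiv_rel := EquivRelPack loc_rel_equiv.

Definition loc := {eq_quot loc_rel}.

HB.instance Definition _ := Choice.on loc.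
HB.instance Definition _ := EqQuotient.on loc.

Definition loc_frac (a : A) (m : nat) : loc := \pi_loc (a, m).

Lemma loc_fracP a m b n :
  loc_frac a m = loc_frac b n <->
  exists k, t ^+ k * (a * t ^+ n) = t ^+ k * (b * t ^+ m).
Proof.
split=> [/eqP|h]; first by rewrite piE => /asboolP.
by apply/eqP; rewrite piE; apply/asboolP.
Qed.

Lemma loc_fracE (x : loc) : exists a m, x = loc_frac a m.
Proof.
by exists (repr x).1, (repr x).2;
rewrite /loc_frac -surjective_pairing reprK.
Qed.

Let add (x y : loc) : loc :=
  loc_frac ((repr x).1 * t ^+ (repr y).2 + (repr y).1 * t ^+ (repr x).2)
           ((repr x).2 + (repr y).2).
Let mul (x y : loc) : loc :=
  loc_frac ((repr x).1 * (repr y).1) ((repr x).2 + (repr y).2).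
Let opp (x : loc) : loc := loc_frac (- (repr x).1) (repr x).2.

Let reprP a m : exists k,
  t ^+ k * ((repr (loc_frac a m)).1 * t ^+ m) =
  t ^+ k * (a * t ^+ (repr (loc_frac a m)).2).
Proof. by apply/loc_fracP; rewrite /loc_frac -surjective_pairing reprK. Qed.

Let addE a m b n : add (loc_frac a m) (loc_frac b n) =
  loc_frac (a * t ^+ n + b * t ^+ m) (m + n).
Proof.
rewrite /add; have [k] := reprP a m; have [l] := reprP b n.
case: (repr (loc_frac a m)) => a' m'; case: (repr (loc_frac b n)) => b' n' /=.
move=> f e; apply/loc_fracP; exists (k + l)%N; rewrite !exprD.
transitivity (t ^+ l * t ^+ n * t ^+ n' * (t ^+ k * (a' * t ^+ m)) +
    t ^+ k * t ^+ m * t ^+ m' * (t ^+ l * (b' * t ^+ n))); first by ring.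
by rewrite e f; ring.
Qed.

Let mulE a m b n :
  mul (loc_frac a m) (loc_frac b n) = loc_frac (a * b) (m + n).
Proof.
rewrite /mul; have [k] := reprP a m; have [l] := reprP b n.
case: (repr (loc_frac a m)) => a' m'; case: (repr (loc_frac b n)) => b' n' /=.
move=> f e; apply/loc_fracP; exists (k + l)%N; rewrite !exprD.
transitivity ((t ^+ k * (a' * t ^+ m)) * (t ^+ l * (b' * t ^+ n)));
  first by ring.
by rewrite e f; ring.
Qed.

Let oppE a m : opp (loc_frac a m) = loc_frac (- a) m.
Proof.
rewrite /opp; have [k] := reprP a m; case: (repr _) => a' m' /= e.
by apply/loc_fracP; exists k; rewrite !mulNr !mulrN e.
Qed.

Let frac_eq a m b n : a * t ^+ n = b * t ^+ m -> loc_frac a m = loc_frac b n.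
Proof. by move=> e; apply/loc_fracP; exists 0%N; rewrite e. Qed.

Let addA : associative add.
Proof.
move=> x y z; have [a [i ->]] := loc_fracE x; have [b [j ->]] := loc_fracE y.
have [c [k ->]] := loc_fracE z; rewrite !addE.
by apply: frac_eq; rewrite !exprD; ring.
Qed.

Let addC : commutative add.
Proof.
move=> x y; have [a [i ->]] := loc_fracE x; have [b [j ->]] := loc_fracE y.
by rewrite !addE addnC addrC.
Qed.

Let add0 : left_id (loc_frac 0 0) add.
Proof.
move=> x; have [a [i ->]] := loc_fracE x.
by rewrite addE; apply: frac_eq; rewrite mul0r expr0 mulr1 add0r.
Qed.

Let addN : left_inverse (loc_frac 0 0) opp add.
Proof.
move=> x; have [a [i ->]] := loc_fracE x; rewrite oppE addE.
by apply: frac_eq; rewrite mulNr addNr !mul0r.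
Qed.

HB.instance Definition _ := GRing.isZmodule.Build loc addA addC add0 addN.

Let mulA : associative mul.
Proof.
move=> x y z; have [a [i ->]] := loc_fracE x; have [b [j ->]] := loc_fracE y.
by have [c [k ->]] := loc_fracE z; rewrite !mulE addnA mulrA.
Qed.

Let mulC : commutative mul.
Proof.
move=> x y; have [a [i ->]] := loc_fracE x; have [b [j ->]] := loc_fracE y.
by rewrite !mulE addnC mulrC.
Qed.

Let mul1 : left_id (loc_frac 1 0) mul.
Proof.
by move=> x; have [a [i ->]] := loc_fracE x; rewrite mulE mul1r.
Qed.

Let mulDl : left_distributive mul add.
Proof.
move=> x y z; have [a [i ->]] := loc_fracE x; have [b [j ->]] := loc_fracE y.
have [c [k ->]] := loc_fracE z; rewrite addE !mulE addE.
by apply: frac_eq; rewrite !exprD; ring.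
Qed.

HB.instance Definition _ :=
  GRing.Zmodule_isComPzRing.Build loc mulA mulC mul1 mulDl.

Lemma loc_fracD a m b n : loc_frac a m + loc_frac b n =
  loc_frac (a * t ^+ n + b * t ^+ m) (m + n).
Proof. exact: addE. Qed.

Lemma loc_fracN a m : - loc_frac a m = loc_frac (- a) m.
Proof. exact: oppE. Qed.

Lemma loc_fracM a m b n :
  loc_frac a m * loc_frac b n = loc_frac (a * b) (m + n).
Proof. exact: mulE. Qed.

Definition loc_map (a : A) : loc := loc_frac a 0.

Lemma loc_map_is_zmod_morphism : zmod_morphism loc_map.
Proof.
move=> x y; rewrite /loc_map loc_fracN loc_fracD.
by apply: frac_eq; rewrite !mulr1.
Qed.

Lemma loc_map_is_monoid_morphism : monoid_morphism loc_map.
Proof. by split=> // x y; rewrite /loc_map loc_fracM. Qed.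

HB.instance Definition _ :=
  GRing.isZmodMorphism.Build A loc loc_map loc_map_is_zmod_morphism.
HB.instance Definition _ :=
  GRing.isMonoidMorphism.Build A loc loc_map loc_map_is_monoid_morphism.

End Localization.

Section CompleteIntegralClosure.
Variables (A B : comPzRingType) (f : {rmorphism A -> B}).
Local Open Scope classical_set_scope.

(* The A-submodule of B generated by S, where A acts on B through f. *)
Definition submodule_gen (S : set B) : set B :=
  [set y | exists (n : nat) (a : 'I_n -> A) (b : 'I_n -> B),
     (forall i, S (b i)) /\ y = \sum_(i < n) f (a i) * b i].

Definition almost_integral (x : B) : Prop :=
  exists s : seq B,
    submodule_gen (range (fun n : nat => x ^+ n)) `<=` submodule_gen [set` s].

(* The first conjunct says that f exhibits B as an extension ring of A; it is
   automatic for [loc_map t] with t a nonzero divisor. *)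
Definition completely_integrally_closed : Prop :=
  injective f /\ forall x : B, almost_integral x -> exists a, f a = x.

End CompleteIntegralClosure.

(* Bijectivity of A -> lim_n A/a^n A, with the elements of the limit
   represented by sequences in A. *)
Definition adically_complete (A : comPzRingType) (a : A) : Prop :=
  forall u : nat -> A,
    (forall n, u n.+1 - u n \in principal (a ^+ n)) ->
    exists! l : A, forall n, l - u n \in principal (a ^+ n).

(* The family of open sets of the a-adic topology. *)
Definition adic_topology (A : comPzRingType) (a : A) : set (set A) :=
  [set U | forall x, U x ->
     exists n, forall y, y - x \in principal (a ^+ n) -> U y]%classic.

Lemma frobD_natp (p : nat) (R : comPzRingType) (x y : R) :
  prime p -> p%:R = 0 :> R -> (x + y) ^+ p = x ^+ p + y ^+ p.
Proof.
case: p => // p p_pr p0; rewrite exprDn big_ord_recr big_ord_recl /=.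
rewrite subn0 subnn mulr1 mul1r bin0 binn big1 ?addr0 // => i _.
rewrite -mulr_natl; have /dvdnP[q ->] : (p.+1 %| 'C(p.+1, bump 0 i))%N.
  by rewrite prime_dvd_bin //= ltnS (valP i).
by rewrite natrM p0 mulr0 mul0r.
Qed.

Section FrobeniusCompatible.
Variables (p : nat) (p_pr : prime p) (A : comPzRingType).

Let quot_natp : p%:R = 0 :> quot_by (p%:R : A).
Proof.
rewrite -(rmorph_nat (quot_proj p%:R)) -(rmorph0 (quot_proj p%:R)).
by apply/quot_projP/principalP; exists 1; rewrite subr0 mulr1.
Qed.

Definition frob_compatible : {pred nat -> quot_by (p%:R : A)} :=
  fun x => `[< forall n, x n.+1 ^+ p = x n >].

Lemma frob_compatible_subring_closed : subring_closed frob_compatible.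
Proof.
split=> [|x y /asboolP xP /asboolP yP|x y /asboolP xP /asboolP yP].
- by apply/asboolP=> n; apply: expr1n.
- apply/asboolP=> n; apply/eqP; rewrite -[_ == _]/(_ == x n - y n).
  rewrite eq_sym subr_eq -xP -yP -frobD_natp //.
  by rewrite -[(x - y) n.+1]/(x n.+1 - y n.+1) subrK.
- by apply/asboolP=> n; rewrite -[LHS]/((x n.+1 * y n.+1) ^+ p) exprMn xP yP.
Qed.

End FrobeniusCompatible.

(* The ring lim (... -> A/pA -> A/pA) along Frobenius, as a subring of the
   ring of all sequences; it depends on the proof that p is prime because it
   is only a ring in that case. *)
Record tilt (p : nat) (p_pr : prime p) (A : comPzRingType) := Tilt {
  tilt_seq :> nat -> quot_by (p%:R : A);
  _ : tilt_seq \in @frob_compatible p A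
}.

HB.instance Definition _ (p : nat) (p_pr : prime p) (A : comPzRingType) :=
  [isSub for @tilt_seq p p_pr A].
HB.instance Definition _ (p : nat) (p_pr : prime p) (A : comPzRingType) :=
  [Choice of @tilt p p_pr A by <:].
HB.instance Definition _ (p : nat) (p_pr : prime p) (A : comPzRingType) :=
  GRing.SubChoice_isSubComPzRing.Build (nat -> quot_by (p%:R : A))
    (@frob_compatible p A) (@tilt p p_pr A)
    (frob_compatible_subring_closed p_pr A).

Definition p_power_roots (p : nat) (A : comPzRingType) (w : A)
    (r : nat -> A) : Prop :=
  r 0%N = w /\ forall n, r n.+1 ^+ p = r n.

Lemma p_power_roots_frob (p : nat) (A : comPzRingType) (w : A) (r : nat -> A) :
  p_power_roots p w r ->
  (fun n => quot_proj p%:R (r n)) \in @frob_compatible p A.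
Proof.
by case=> _ rS; apply/asboolP => n; rewrite -rmorphXn rS.
Qed.

(* The element (..., r 2, r 1, r 0) of the tilt. *)
Definition tilt_elt (p : nat) (p_pr : prime p) (A : comPzRingType) (w : A)
    (r : nat -> A) (h : p_power_roots p w r) : tilt p_pr A :=
  Tilt p_pr (p_power_roots_frob h).

(* Main.v *)
Require Import Defs.
From mathcomp Require Import all_boot all_order all_algebra.
From mathcomp Require Import boolp classical_sets.

(** Write [x^#] for the untilt of an element [x] of the tilt. When [A] is
    [p]-adically complete, [x |-> x^#] is a multiplicative map from the tilt
    to [A]: [x^#] is the limit of the [p ^ n]-th powers of lifts of [x n], and
    the roots [(x^(1/p^k))^#] recover the components [x k] modulo [p].

    If [x / varpi_flat ^ m] is almost integral, some [c] is such that
    [varpi_flat ^ m n] divides [varpi_flat ^ c x ^ n] for all [n]. The untilt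
    carries this relation to [A], so that [x^# / varpi ^ m] is almost integral
    over [A] and [varpi ^ m] divides [x^#]. As [A] is closed under [p ^ k]-th
    roots in [A[1/varpi]], it follows that [(x^(1/p^k))^#] is
    [varpi ^ (m/p^k) * y k] for some [y k] in [A]. Cancelling powers of
    [varpi] in [((x^(1/p^(k+1)))^#)^p = (x^(1/p^k))^#] gives
    [y k.+1 ^ p = y k], so the [y k] modulo [p] form an element of the tilt,
    whose product with [varpi_flat ^ m] is [x].

    Without completeness [x^#] does not exist in [A]; it exists only modulo
    each power of [p]. All the steps above survive, however, when the
    identities in [A] are weakened to congruences modulo [p varpi ^ N] with [N]
    large: the factor [varpi ^ N] leaves room to cancel powers of [varpi], and
    the factor [p] keeps the result meaningful in [A/pA]. When the [varpi]-adic
    and [p]-adic topologies agree, a power of [p] is a multiple of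
    [p varpi ^ N], and approximate untilts are enough. Both assertions are
    thus instances of [tilt_completely_integrally_closed], which is
    parametrized by the precision to which untilts are known:
    [sharp_mod] is the untilt modulo [p ^ n.+1], [sharp_lift] a lift of it to
    [A], and [sharp_lift_divisible] the passage from the tilt to [A]. *)

Set Implicit Arguments.
Unset Strict Implicit.
Unset Printing Implicit Defensive.

Import GRing.Theory.

Local Open Scope ring_scope.

(** * Principal ideals *)

Section Principal.
Variable A : comPzRingType.
Implicit Types a b u v : A.

Lemma principalM a b : a * b \in principal a.
Proof. by apply/principalP; exists b. Qed.

Lemma principalMr a u v : u \in principal a -> u * v \in principal a.
Proof. by rewrite mulrC; exact: principalMl. Qed.

Lemma principal_id a : a \in principal a.
Proof. by rewrite -{1}[a]mulr1 principalM. Qed.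

Lemma principal_trans a b u :
  b \in principal a -> u \in principal b -> u \in principal a.
Proof.
move=> /principalP[c ->] /principalP[d ->]; rewrite -mulrA; exact: principalM.
Qed.

Lemma principal_mul a b u v :
  u \in principal a -> v \in principal b -> u * v \in principal (a * b).
Proof.
by move=> /principalP[c ->] /principalP[d ->]; rewrite mulrACA principalM.
Qed.

Lemma principal_pow a u n :
  u \in principal a -> u ^+ n \in principal (a ^+ n).
Proof. by move=> /principalP[c ->]; rewrite exprMn principalM. Qed.

Lemma principal_expn a m n : (m <= n)%N -> a ^+ n \in principal (a ^+ m).
Proof. by move=> mn; rewrite -(subnKC mn) exprD principalM. Qed.

Lemma principal_cancel a b u :
  GRing.lreg a -> a * u \in principal (a * b) -> u \in principal b.
Proof.
move=> a_reg /principalP[c]; rewrite -mulrA => /a_reg ->.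
exact: principalM.
Qed.

Lemma quot_proj0 a u : quot_proj a u = 0 <-> u \in principal a.
Proof. by rewrite -(rmorph0 (quot_proj a)) quot_projP subr0. Qed.

End Principal.

(** * Complete integral closedness in a localization *)

Section CompleteIntegralClosureLocalization.
Variables (A : comPzRingType) (t : A).
Hypothesis t_reg : GRing.lreg t.

Lemma loc_frac_mapP x m a :
  loc_frac t x m = loc_map t a <-> x = t ^+ m * a.
Proof.
rewrite loc_fracP; split=> [[k /(lregX t_reg)]|->].
  by rewrite mulr1 mulrC => ->; rewrite mulrC.
by exists 0%N; rewrite mulr1 [a * _]mulrC.
Qed.

Lemma loc_map_inj : injective (loc_map t).
Proof. by move=> x y /loc_frac_mapP; rewrite mul1r. Qed.

Lemma loc_fracX x m n : loc_frac t x m ^+ n = loc_frac t (x ^+ n) (m * n).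
Proof.
elim: n => [|n IHn]; first by rewrite muln0.
by rewrite !exprS IHn loc_fracM mulnS.
Qed.

Lemma loc_map_frac a x m : loc_map t a * loc_frac t x m = loc_frac t (a * x) m.
Proof. exact: loc_fracM. Qed.

(** A finite set of generators has a common denominator; this is how finite
    generation enters the bound of [almost_integral_frac]. *)
Lemma common_denominator (s : seq (loc t)) :
  exists c, forall b, b \in s -> exists a, loc_map t (t ^+ c) * b = loc_map t a.
Proof.
elim: s => [|b s [c IHs]]; first by exists 0%N.
have [x [m ->]] := loc_fracE b.
exists (c + m)%N => b'; rewrite inE => /predU1P[->|/IHs[a e]].
  exists (t ^+ c * x); rewrite loc_map_frac; apply/loc_frac_mapP.
  by rewrite exprD mulrAC mulrC.
exists (t ^+ m * a).
by rewrite exprD [t ^+ c * _]mulrC rmorphM -mulrA e -rmorphM.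
Qed.

(** Almost integrality as a divisibility inside [A]: the exponent [c] clears the
    denominators of a finitely generated module containing all powers of
    [x / t ^ m], and conversely these powers then lie in the cyclic module
    generated by [1 / t ^ c]. *)
Lemma almost_integral_frac x m :
  almost_integral (loc_map t) (loc_frac t x m) <->
  exists c, forall n, t ^+ c * x ^+ n \in principal (t ^+ (m * n)).
Proof.
split=> [[s s_gen]|[c cP]].
  have [c cP] := common_denominator s; exists c => n.
  have /s_gen[k [a [b [b_s eq_n]]]] :
      submodule_gen (loc_map t) (range (fun n => loc_frac t x m ^+ n))
        (loc_frac t x m ^+ n).
    exists 1%N, (fun=> 1), (fun=> loc_frac t x m ^+ n).
    by split=> [_|]; [exists n | rewrite big_ord1 rmorph1 mul1r].
  have /choice[d dP] : forall i, exists d,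
      loc_map t (t ^+ c) * b i = loc_map t d.
    by move=> i; apply/cP/b_s.
  apply/principalP; exists (\sum_i a i * d i); apply/loc_frac_mapP.
  rewrite -loc_map_frac -loc_fracX eq_n mulr_sumr rmorph_sum.
  by apply: eq_bigr => i _; rewrite mulrCA dP rmorphM.
exists [:: loc_frac t 1 c] => y [k [a [b [b_pow ->]]]].
have /choice[d dP] : forall i, exists d, b i = loc_map t d * loc_frac t 1 c.
  move=> i; have [n _ <-] := b_pow i.
  have /principalP[d e] := cP n; exists d.
  rewrite loc_fracX loc_map_frac mulr1.
  by apply/loc_fracP; exists 0%N; rewrite !mul1r mulrC e mulrC.
exists k, (fun i => a i * d i), (fun=> loc_frac t 1 c); split=> [i|].
  exact: mem_head.
by apply: eq_bigr => i _; rewrite dP rmorphM mulrA.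
Qed.

Lemma completely_integrally_closedP :
  completely_integrally_closed (loc_map t) <->
  forall x m c, (forall n, t ^+ c * x ^+ n \in principal (t ^+ (m * n))) ->
    x \in principal (t ^+ m).
Proof.
split=> [[_ cic] x m c xP|cic].
  have [|a /esym/loc_frac_mapP ->] := cic (loc_frac t x m).
    by apply/almost_integral_frac; exists c.
  exact: principalM.
split=> [|y]; first exact: loc_map_inj.
have [x [m ->]] := loc_fracE y.
move=> /almost_integral_frac[c /cic/principalP[a xE]].
by exists a; apply/esym/loc_frac_mapP.
Qed.

(** [u / s ^ m] is a [q]-th root of an element of [A], hence almost integral
    over [A]: its powers are bounded by those of exponent less than [q]. Since
    [s] is not the inverted element, the fraction has to be rewritten over
    [t ^ m], with numerator [s ^ q.-1 ^ m * u]. *)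
Lemma root_principal (s : A) (q m : nat) (u : A) :
  completely_integrally_closed (loc_map t) -> s ^+ q = t -> (0 < q)%N ->
  u ^+ q \in principal (t ^+ m) -> u \in principal (s ^+ m).
Proof.
move=> /completely_integrally_closedP cic sq q_gt0 uq.
have s_reg : GRing.lreg s.
  move=> a b; rewrite -(prednK q_gt0) exprSr in sq.
  by move=> /= e; apply: t_reg; rewrite /= -sq -!mulrA e.
set w := s ^+ q.-1; have tE i : t ^+ i = w ^+ i * s ^+ i.
  by rewrite -exprMn -exprSr prednK // sq.
apply: (@principal_cancel _ (w ^+ m)); first by do 2!apply: lregX.
rewrite -tE; apply: (cic _ _ m) => n.
rewrite [t ^+ (m * n)]tE [w ^+ (m * n)]exprM exprMn mulrCA.
apply: principal_mul; first exact: principal_id.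
(* The [n %% q] remaining factors [u] need not be divisible by [s ^ m]: the
   extra factor [t ^ m] makes up for them. *)
have -> : u ^+ n = (u ^+ q) ^+ (n %/ q) * u ^+ (n %% q).
  by rewrite -exprM -exprD mulnC -divn_eq.
rewrite mulrA.
apply: principalMr.
apply: (@principal_trans _ _ (t ^+ (m * (n %/ q).+1))).
  rewrite -sq -exprM; apply: principal_expn.
  by rewrite mulnCA leq_mul2l mulnC (ltnW (ltn_ceil _ _)) ?orbT.
rewrite mulnS exprD exprM; apply: principal_mul; last exact: principal_pow.
exact: principal_id.
Qed.

End CompleteIntegralClosureLocalization.

(** * The untilt modulo powers of p *)

Section SharpModulo.
Variables (p : nat) (p_pr : prime p) (A : comPzRingType).
Implicit Types (x y : tilt p_pr A) (a b : A) (n k : nat).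

Lemma tilt_frob x n : x n.+1 ^+ p = x n.
Proof. by case: x => x /= /asboolP. Qed.

Lemma tilt_eq x y : (forall n, x n = y n) -> x = y.
Proof. by move=> xy; apply/val_inj/funext. Qed.

Lemma tiltM x y n : (x * y) n = x n * y n.
Proof. by []. Qed.

Lemma tiltX x m n : (x ^+ m) n = x n ^+ m.
Proof. by elim: m => // m IHm; rewrite !exprS tiltM IHm. Qed.

(** Raising to the power [p] gains one power of [p]: in the factorization of
    [a ^ p - b ^ p], the cofactor of [a - b] is congruent to [p b ^ p.-1]
    modulo [p]. *)
Lemma eq_mod_exp_prime i a b :
  a - b \in principal (p%:R ^+ i.+1) ->
  a ^+ p - b ^+ p \in principal (p%:R ^+ i.+2).
Proof.
move=> ab; rewrite subrXX exprSr; apply: principal_mul => //.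
apply/quot_proj0; rewrite rmorph_sum /=.
have ab1 : quot_proj p%:R a = quot_proj p%:R b.
  apply/quot_projP; apply: principal_trans ab.
  by rewrite exprS principalM.
rewrite (eq_bigr (fun=> quot_proj p%:R (b ^+ p.-1))) => [|j _].
  rewrite sumr_const card_ord -rmorphMn; apply/quot_proj0.
  by rewrite -[_ *+ p]mulr_natl principalM.
rewrite rmorphM !rmorphXn /= ab1 -exprD subnK //.
by rewrite -ltnS prednK ?prime_gt0.
Qed.

Lemma eq_mod_exp_pow_prime n a b :
  quot_proj p%:R a = quot_proj p%:R b ->
  quot_proj (p%:R ^+ n.+1) (a ^+ (p ^ n)) =
  quot_proj (p%:R ^+ n.+1) (b ^+ (p ^ n)).
Proof.
move=> /quot_projP ab; apply/quot_projP; elim: n => // n IHn.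
by rewrite expnSr !exprM; apply: eq_mod_exp_prime.
Qed.

(** The residue class of the untilt of the [p ^ k]-th root of [x], that is of
    the sequence [x] shifted by [k]. *)
Definition sharp_mod n k x : quot_by (p%:R ^+ n.+1 : A) :=
  quot_proj (p%:R ^+ n.+1) (repr (x (k + n)%N) ^+ (p ^ n)).

(** Independence of the lift; the algebraic properties of [sharp_mod] follow by
    choosing suitable lifts. *)
Lemma sharp_modE n k x b :
  quot_proj p%:R b = x (k + n)%N ->
  sharp_mod n k x = quot_proj (p%:R ^+ n.+1) (b ^+ (p ^ n)).
Proof. by move=> bx; apply: eq_mod_exp_pow_prime; rewrite quot_projK bx. Qed.

Lemma sharp_modM n k x y :
  sharp_mod n k (x * y) = sharp_mod n k x * sharp_mod n k y.
Proof.
rewrite -rmorphM -exprMn; apply: sharp_modE.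
by rewrite rmorphM /= !quot_projK.
Qed.

Lemma sharp_mod0 n k : sharp_mod n k 0 = 0.
Proof.
rewrite (@sharp_modE n k 0 0) ?rmorph0 // expr0n expn_eq0.
by rewrite eqn0Ngt prime_gt0 //= rmorph0.
Qed.

Lemma sharp_mod_frob n k x : sharp_mod n k.+1 x ^+ p = sharp_mod n k x.
Proof.
have -> : sharp_mod n k.+1 x ^+ p =
    quot_proj (p%:R ^+ n.+1) (repr (x (k.+1 + n)%N) ^+ p ^+ (p ^ n)).
  by rewrite exprAC rmorphXn.
apply/esym/sharp_modE.
by rewrite rmorphXn /= quot_projK addSn tilt_frob.
Qed.

Lemma sharp_mod_tilt_elt w r (h : p_power_roots p w r) n k :
  sharp_mod n k (tilt_elt p_pr h) = quot_proj (p%:R ^+ n.+1) (r k).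
Proof.
rewrite (@sharp_modE n k _ (r (k + n)%N)) //; congr quot_proj.
elim: n => [|n IHn]; first by rewrite addn0.
by rewrite addnS expnS exprM h.2.
Qed.

Lemma sharp_mod_proj k x a :
  quot_proj (p%:R ^+ 1) a = sharp_mod 0 k x -> quot_proj p%:R a = x k.
Proof.
move=> /quot_projP ax; rewrite -[RHS]quot_projK -[k]addn0.
exact/quot_projP.
Qed.

(** The residue classes [sharp_mod n k x] are compatible for varying [n]. The
    proof evaluates the coarser one on a [p ^ (n - m)]-th power of the lift
    that defines the finer one. *)
Lemma sharp_mod_le m n k x a : (m <= n)%N ->
  quot_proj (p%:R ^+ n.+1) a = sharp_mod n k x ->
  quot_proj (p%:R ^+ m.+1) a = sharp_mod m k x.
Proof.
move=> mn /quot_projP a_n.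
have bx : quot_proj p%:R (repr (x (k + n)%N) ^+ (p ^ (n - m))) = x (k + m)%N.
  rewrite rmorphXn /= quot_projK -{1}(subnK mn); elim: (n - m)%N => [|d IHd].
    by rewrite expr1.
  by rewrite expnS exprM addSn addnS tilt_frob.
rewrite (sharp_modE bx) -exprM -expnD subnK //.
by apply/quot_projP/(principal_trans _ a_n)/principal_expn.
Qed.

End SharpModulo.

(** * Complete integral closedness of the tilt *)

Section Precision.
Variables (p : nat) (p_pr : prime p) (A : comPzRingType).
Variables (varpi : A) (varpi_reg : GRing.lreg varpi).
Variables (r : nat -> A) (hr : p_power_roots p varpi r).
(* [D N] is a set of exponents [n] such that congruences modulo [p ^ n.+1] for
   all [n] in [D N] amount to precision [p varpi ^ N] or better. It consists of
   all [n] when exact untilts exist, and is a finite segment otherwise. *)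
Variable D : nat -> nat -> Prop.
Implicit Types (x y : tilt p_pr A) (a b : A) (N n k : nat).

Let varpi_flat := tilt_elt p_pr hr.

Definition sharp_lift N k x a :=
  forall n, D N n -> quot_proj (p%:R ^+ n.+1) a = sharp_mod n k x.

Hypothesis D0 : forall N, D N 0.
Hypothesis D_mono : forall M N n, (M <= N)%N -> D M n -> D N n.
Hypothesis D_small : forall N a,
  (forall n, D N n -> a \in principal (p%:R ^+ n.+1)) ->
  a \in principal (p%:R * varpi ^+ N).
Hypothesis D_lift : forall N k x, exists a, sharp_lift N k x a.

Lemma sharp_lift_uniq N k x a b : sharp_lift N k x a -> sharp_lift N k x b ->
  a - b \in principal (p%:R * varpi ^+ N).
Proof.
by move=> xa xb; apply: D_small => n Dn; apply/quot_projP; rewrite xa ?xb.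
Qed.

Lemma sharp_liftM N k x y a b : sharp_lift N k x a -> sharp_lift N k y b ->
  sharp_lift N k (x * y) (a * b).
Proof. by move=> xa yb n Dn; rewrite rmorphM /= xa // yb // sharp_modM. Qed.

Lemma sharp_lift0 N k : sharp_lift N k 0 0.
Proof. by move=> n _; rewrite rmorph0 sharp_mod0. Qed.

Lemma sharp_lift1 N k : sharp_lift N k 1 1.
Proof.
move=> n _; rewrite (@sharp_modE _ _ _ _ _ _ 1) ?rmorph1 ?expr1n ?rmorph1 //.
Qed.

Lemma sharp_liftX N k x a m :
  sharp_lift N k x a -> sharp_lift N k (x ^+ m) (a ^+ m).
Proof.
move=> xa; elim: m => [|m IHm]; first exact: sharp_lift1.
by rewrite !exprS; apply: sharp_liftM.
Qed.

Lemma sharp_lift_root N k : sharp_lift N k varpi_flat (r k).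
Proof. by move=> n _; rewrite sharp_mod_tilt_elt. Qed.

Lemma sharp_lift_frob N k x a :
  sharp_lift N k.+1 x a -> sharp_lift N k x (a ^+ p).
Proof. by move=> xa n Dn; rewrite rmorphXn /= xa // sharp_mod_frob. Qed.

Lemma sharp_lift_frobn N k x a :
  sharp_lift N k x a -> sharp_lift N 0 x (a ^+ (p ^ k)).
Proof.
elim: k a => [//|k IHk] a /sharp_lift_frob /IHk.
by rewrite -exprM expnS.
Qed.

Lemma sharp_lift_le M N k x a :
  (M <= N)%N -> sharp_lift N k x a -> sharp_lift M k x a.
Proof. by move=> MN xa n Dn; apply/xa/(D_mono MN). Qed.

Lemma sharp_lift_proj N k x a : sharp_lift N k x a -> quot_proj p%:R a = x k.
Proof. by move=> xa; apply/sharp_mod_proj/xa. Qed.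

Lemma rootX k : r k ^+ (p ^ k) = varpi.
Proof.
by elim: k => [|k IHk]; [rewrite expr1 hr.1 | rewrite expnS exprM hr.2].
Qed.

Lemma root_dvd k : varpi \in principal (r k).
Proof.
have pk_gt0 : (0 < p ^ k)%N by rewrite expn_gt0 prime_gt0.
by rewrite -{1}(rootX k) -(prednK pk_gt0) exprS principalM.
Qed.

Lemma root_reg k : GRing.lreg (r k).
Proof.
have /principalP[d e] := root_dvd k.
by move=> a b ab; apply: varpi_reg; rewrite /= e ![r k * d]mulrC -!mulrA ab.
Qed.

(** Cancelling [r k ^ m] uses up at most the factor [varpi ^ N] of the
    precision, and the congruence modulo [p] remains. *)
Lemma root_cancel k m N a : (m <= N)%N ->
  r k ^+ m * a \in principal (p%:R * varpi ^+ N) -> a \in principal p%:R.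
Proof.
move=> mN ma; apply: (@principal_cancel _ (r k ^+ m)).
  by apply/lregX/root_reg.
apply: principal_trans ma; rewrite mulrC; apply: principal_mul.
  exact: principal_trans (principal_pow _ (root_dvd k)) (principal_expn _ mN).
exact: principal_id.
Qed.

Lemma tilt_elt_reg : GRing.lreg varpi_flat.
Proof.
move=> x y /= xy; apply: tilt_eq => k; apply: subr0_eq.
have [a za] := D_lift 1 k (x - y).
rewrite -[LHS]/((x - y) k) -(sharp_lift_proj za); apply/quot_proj0.
apply: (@root_cancel k 1 1) => //.
have z0 : varpi_flat * (x - y) = 0 by rewrite mulrBr xy subrr.
have := sharp_liftM (@sharp_lift_root 1 k) za; rewrite z0 => /sharp_lift_uniq.
by move=> /(_ _ (@sharp_lift0 1 k)); rewrite subr0.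
Qed.

Hypothesis cic : completely_integrally_closed (loc_map varpi).

(** The passage from the tilt to [A]: the untilt of [x] is divisible by
    [varpi ^ m], because its quotient by [varpi ^ m] is almost integral. The
    precision needed to read off the [n]-th divisibility grows with [n]
    whereas [s] is fixed, so each [n] uses a finer lift [t] of its own. As [s]
    and [t] differ by a multiple of [varpi ^ m], the binomial formula carries
    the divisibility from the powers of [t] to those of [s]. *)
Lemma sharp_lift_divisible x m c N s :
    (forall n,
      varpi_flat ^+ c * x ^+ n \in principal (varpi_flat ^+ (m * n))) ->
  (m <= N)%N -> sharp_lift N 0 x s -> s \in principal (varpi ^+ m).
Proof.
move=> xP mN xs.
apply: ((completely_integrally_closedP varpi_reg).1 cic s m c) => n.
pose M := maxn N (m * n); have [t xt] := D_lift M 0 x.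
have st : s - t \in principal (varpi ^+ m).
  have tN := sharp_lift_le (leq_maxl N (m * n)) xt.
  apply: principal_trans (sharp_lift_uniq xs tN).
  exact/principalMl/principal_expn.
have t_pow i : (i <= n)%N ->
    varpi ^+ c * t ^+ i \in principal (varpi ^+ (m * i)).
  move=> le_in; have /principalP[z xz] := xP i; have [b zb] := D_lift M 0 z.
  have lift_varpi j : sharp_lift M 0 (varpi_flat ^+ j) (varpi ^+ j).
    by rewrite -hr.1; apply/sharp_liftX/sharp_lift_root.
  have := sharp_liftM (lift_varpi c) (sharp_liftX i xt); rewrite xz.
  move=> /sharp_lift_uniq/(_ (sharp_liftM (lift_varpi (m * i)%N) zb)) tz.
  rewrite -[_ * t ^+ i](subrK (varpi ^+ (m * i) * b)) rpredD ?principalM //.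
  apply: principal_trans tz; apply/principalMl/principal_expn.
  by rewrite (leq_trans _ (leq_maxr _ _)) // leq_mul2l le_in orbT.
rewrite -[s](subrK t) exprDn mulr_sumr rpred_sum // => i _.
have le_in : (i <= n)%N by rewrite -ltnS ltn_ord.
have -> : varpi ^+ (m * n) = (varpi ^+ m) ^+ (n - i) * varpi ^+ (m * i).
  by rewrite -exprM -exprD -mulnDr subnK.
rewrite mulrnAr rpredMn // mulrCA.
exact: principal_mul (principal_pow _ st) (t_pow _ le_in).
Qed.

Lemma tilt_completely_integrally_closed :
  completely_integrally_closed (loc_map varpi_flat).
Proof.
apply/(completely_integrally_closedP tilt_elt_reg) => x m c xP.
have /choice[y xy] : forall k, exists b, sharp_lift m k x (r k ^+ m * b).
  move=> k; have [a xa] := D_lift m k x.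
  have /principalP[y ay] : a \in principal (r k ^+ m).
    apply: (root_principal varpi_reg cic (rootX k)).
      by rewrite expn_gt0 prime_gt0.
    exact: sharp_lift_divisible xP (leqnn m) (sharp_lift_frobn xa).
  by exists y; rewrite -ay.
have y_frob : (fun k => quot_proj p%:R (y k)) \in @frob_compatible p A.
  apply/asboolP => k; rewrite -rmorphXn; apply/quot_projP.
  apply: (@root_cancel k m m) => //; rewrite mulrBr.
  have := sharp_lift_uniq (sharp_lift_frob (xy k.+1)) (xy k).
  by rewrite exprMn exprAC hr.2.
apply/principalP; exists (Tilt p_pr y_frob); apply: tilt_eq => k.
by rewrite tiltM tiltX -(sharp_lift_proj (xy k)) rmorphM rmorphXn.
Qed.

End Precision.

(** * Exact untilts in the complete case *)

Section CompleteUntilt.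
Variables (p : nat) (p_pr : prime p) (A : comPzRingType).

Lemma complete_separated (a d : A) : adically_complete a ->
  (forall n, d \in principal (a ^+ n.+1)) -> d = 0.
Proof.
move=> compl d0.
have [n|l [_ l_uniq]] := compl (fun=> 0); first by rewrite subrr rpred0.
rewrite -(l_uniq d) => [|n].
  by apply: l_uniq => n; rewrite subr0 rpred0.
by rewrite subr0; apply: principal_trans (d0 n); apply: principal_expn.
Qed.

Lemma complete_sharp k (x : tilt p_pr A) : adically_complete (p%:R : A) ->
  exists a, forall n, quot_proj (p%:R ^+ n.+1) a = sharp_mod n k x.
Proof.
move=> compl; pose u n := repr (x (k + n)%N) ^+ (p ^ n).
have u_cauchy n : u n.+1 - u n \in principal (p%:R ^+ n.+1).
  exact/quot_projP/(sharp_mod_le (leqnSn n)).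
have [n|l [l_lim _]] := compl u.
  exact: principal_trans (principal_expn _ (leqnSn n)) (u_cauchy n).
(* The limit is only known to agree with [u n] modulo [p ^ n]; the missing power
   of [p] comes from passing through [u n.+1]. *)
exists l => n; apply/quot_projP; rewrite -(subrK (u n.+1) l) -addrA.
by rewrite rpredD.
Qed.

End CompleteUntilt.

(** * The two assertions *)

Theorem theorem1 (p : nat) (p_pr : prime p) (A : comPzRingType)
  (varpi : A) (varpi_reg : GRing.lreg varpi)
  (r : nat -> A) (hr : p_power_roots p varpi r) :
  (adically_complete (p%:R : A) ->
   completely_integrally_closed (loc_map varpi) ->
   completely_integrally_closed (loc_map (tilt_elt p_pr hr)))
  /\
  (completely_integrally_closed (loc_map varpi) ->
   adic_topology varpi = adic_topology (p%:R : A) ->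
   completely_integrally_closed (loc_map (tilt_elt p_pr hr))).
Proof.
split=> [compl cic | cic topE].
  apply: (@tilt_completely_integrally_closed _ _ _ _ varpi_reg _ _
    (fun _ _ => True)) => // [N a a0|N k x].
    by rewrite (complete_separated compl (fun n => a0 n I)) rpred0.
  have [a xa] := complete_sharp k x compl.
  by exists a => n _; apply: xa.
(* The ideal generated by [varpi] is a neighbourhood of 0, hence contains a
   power of [p]. *)
have [e pe] : exists e, p%:R ^+ e \in principal varpi.
  have : adic_topology varpi [set a | a \in principal varpi]%classic.
    move=> x /= x_w; exists 1%N => y xy.
    by rewrite -(subrK x y) rpredD.
  rewrite topE => /(_ 0 (rpred0 _))[e e_sub]; exists e.
  by apply: e_sub; rewrite subr0 principal_id.
apply: (@tilt_completely_integrally_closed _ _ _ _ varpi_reg _ _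
  (fun N n => (n <= e * N)%N)) => // [M N n MN|N a a0|N k x].
- by move=> /leq_trans; apply; rewrite leq_mul2l MN orbT.
- apply: principal_trans (a0 _ (leqnn _)); rewrite exprS exprM.
  exact: principal_mul (principal_id _) (principal_pow _ pe).
- (* A lift of the finest residue class lifts all the others. *)
  exists (repr (x (k + e * N)%N) ^+ (p ^ (e * N))) => n n_le.
  exact: (sharp_mod_le n_le).
Qed.
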